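(* Suppose $r_{jk}=0$ for all $(j,k)\in\mathcal{E}$ (so $\kappa=\frac{\pi}{2}$). Consider the closed-loop inverter network $$\frac{d}{dt}v_k=\omega_0Jv_k+\eta\big(K_kv_k-R(\kappa)i_{o,k}\big)+\alpha\Phi_k(v_k)v_k,\qquad k\in\mathcal{V},$$ described in the context. In polar coordinates $\nu_k=\|v_k\|>0$, $v_k=R(\theta_k)\begin{bmatrix}\nu_k\\0\end{bmatrix}$, the closed loop is given by $$\dot\nu_k=\eta\left(\frac{q_k^\star}{v_k^{\star2}}-\frac{q_k}{\nu_k^2}\right)\nu_k+\frac{\alpha}{v_k^\star}(v_k^\star-\nu_k)\nu_k,\qquad \dot\theta_k=\omega_0+\eta\left(\frac{p_k^\star}{v_k^{\star2}}-\frac{p_k}{\nu_k^2}\right),$$ for all $k\in\mathcal{V}$, where $p_k=v_k^\top i_{o,k}$ and $q_k=v_k^\top Ji_{o,k}$ are the active and reactive powers injected by the $k$-th inverter.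
   Context: $\mathcal{G}=(\mathcal{V},\mathcal{E},\{w_{jk}\})$ is a simple connected undirected graph on $\mathcal{V}=\{1,\dots,N\}$; line $(j,k)\in\mathcal{E}$ has resistance $r_{jk}$ and inductance $\ell_{jk}>0$; $\omega_0>0$; $w_{jk}=1/\sqrt{r_{jk}^2+\omega_0^2\ell_{jk}^2}$; $\eta,\alpha>0$. $R(\theta)=\begin{bmatrix}\cos\theta&-\sin\theta\\ \sin\theta&\cos\theta\end{bmatrix}$, $J=R(\pi/2)$. $v=(v_1,\dots,v_N)$ with voltages $v_k\in\mathbb{R}^2$. The output currents $i_o=(i_{o,1},\dots,i_{o,N})\in\mathbb{R}^{2N}$ are $i_o=\mathcal{Y}v$ with $\mathcal{Y}=\mathcal{B}(\mathbf{R}_T+\omega_0(I_M\otimes J)\mathbf{L}_T)^{-1}\mathcal{B}^\top$, where $M=|\mathcal{E}|$, $\mathcal{B}=B\otimes I_2$, $B\in\mathbb{R}^{N\times M}$ is the oriented incidence matrix of $\mathcal{G}$ (for an arbitrary orientation), and $\mathbf{R}_T=R_T\otimes I_2$, $\mathbf{L}_T=L_T\otimes I_2$ with $R_T,L_T$ the diagonal matrices of line resistances and inductances. With $\kappa=\pi/2$ one has $R(\kappa)i_{o,k}=\sum_{j:(j,k)\in\mathcal{E}}w_{jk}(v_k-v_j)$. Set-points: $v_k^\star>0$ and angle set-points $\theta_{jk}^\star=\theta_{j1}^\star-\theta_{k1}^\star$; $K_k=\sum_{j:(j,k)\in\mathcal{E}}w_{jk}\big(I_2-\frac{v_j^\star}{v_k^\star}R(\theta_{jk}^\star)\big)$;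 $\Phi_k(v_k)=\frac{v_k^\star-\|v_k\|}{v_k^\star}$. The power set-points $p_k^\star,q_k^\star$ are those determined by the power-flow equations, for all $k\in\mathcal{V}$: $$p_k^\star=\sum_{j:(j,k)\in\mathcal{E}}\frac{v_k^{\star2}r_{jk}-v_k^\star v_j^\star(r_{jk}\cos\theta_{jk}^\star+\omega_0\ell_{jk}\sin\theta_{jk}^\star)}{r_{jk}^2+\omega_0^2\ell_{jk}^2},$$ $$q_k^\star=\sum_{j:(j,k)\in\mathcal{E}}\frac{v_k^{\star2}\omega_0\ell_{jk}-v_k^\star v_j^\star(\omega_0\ell_{jk}\cos\theta_{jk}^\star-r_{jk}\sin\theta_{jk}^\star)}{r_{jk}^2+\omega_0^2\ell_{jk}^2}.$$ *)

(* Defs.v *)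
From HB Require Import structures.
From mathcomp Require Import all_boot all_order all_algebra.
From mathcomp Require Import all_classical all_reals all_analysis.
From mathcomp Require Export mxtens.
Set Implicit Arguments.
Unset Strict Implicit.
Unset Printing Implicit Defensive.
Import Order.TTheory GRing.Theory Num.Theory.
Import numFieldNormedType.Exports.

Local Open Scope ring_scope.

Section Plane.
Context {R : realType}.

Definition Rot (a : R) : 'M[R]_2 :=
  \matrix_(i < 2, j < 2)
    (if i == j then cos a else if (i < j)%N then - sin a else sin a).

Definition J : 'M[R]_2 := Rot (pi / 2).

Definition col2 (x y : R) : 'cV[R]_2 := \col_(i < 2) [:: x; y]`_i.

(* The library norm on matrices is the maximum norm. *)
Definition enorm (x : 'cV[R]_2) : R := Num.sqrt (\sum_(i < 2) x i 0 ^+ 2).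

Definition dotmul (x y : 'cV[R]_2) : R := (x^T *m y) 0 0.

End Plane.

Section Graph.
Context {N : nat}.

Definition simple_graph (adj : rel 'I_N) : Prop :=
  symmetric adj /\ irreflexive adj.

Definition connected_graph (adj : rel 'I_N) : Prop :=
  forall j k, connect adj j k.

Definition lines (adj : rel 'I_N) : {set {set 'I_N}} :=
  [set [set p.1; p.2] | p in [set p : 'I_N * 'I_N | adj p.1 p.2]].

(* An orientation names, for each line m, its two end points as the source
   src m and the sink snk m; lines are numbered by enum_val. *)
Definition orientation (adj : rel 'I_N) (src snk : 'I_#|lines adj| -> 'I_N) :
    Prop :=
  forall m, [set src m; snk m] = enum_val m.

End Graph.

(* Resistances and inductances are functions r, l on lines, i.e. on unordered
   pairs of nodes: r_jk is r [set j; k].  All sums over j range over the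
   neighbours of k. *)
Section Network.
Context {R : realType} {N : nat}.
Variables (adj : rel 'I_N) (src snk : 'I_#|lines adj| -> 'I_N).
Variables (r l : {set 'I_N} -> R) (omega0 : R).

Local Notation M := #|lines adj|.

Definition incidence : 'M[R]_(N, M) :=
  \matrix_(k < N, m < M) ((k == src m)%:R - (k == snk m)%:R).

Definition line_diag (f : {set 'I_N} -> R) : 'M[R]_M :=
  diag_mx (\row_(m < M) f (enum_val m)).

Definition admittance : 'M[R]_(N * 2) :=
  let B2 := incidence *t (1%:M : 'M[R]_2) in
  let RT := line_diag r *t (1%:M : 'M[R]_2) in
  let LT := line_diag l *t (1%:M : 'M[R]_2) in
  B2 *m invmx (RT + omega0 *: (((1%:M : 'M[R]_M) *t J) *m LT)) *m B2^T.

Definition stack (u : 'I_N -> 'cV[R]_2) : 'cV[R]_(N * 2) :=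
  \col_i u (mxtens_unindex i).1 (mxtens_unindex i).2 0.

Definition block (x : 'cV[R]_(N * 2)) (k : 'I_N) : 'cV[R]_2 :=
  \col_a x (mxtens_index (k, a)) 0.

Definition output_current (u : 'I_N -> 'cV[R]_2) (k : 'I_N) : 'cV[R]_2 :=
  block (admittance *m stack u) k.

Definition active_power (u : 'I_N -> 'cV[R]_2) (k : 'I_N) : R :=
  dotmul (u k) (output_current u k).

Definition reactive_power (u : 'I_N -> 'cV[R]_2) (k : 'I_N) : R :=
  dotmul (u k) (J *m output_current u k).

Definition weight (j k : 'I_N) : R :=
  1 / Num.sqrt (r [set j; k] ^+ 2 + omega0 ^+ 2 * l [set j; k] ^+ 2).

(* vs k is the voltage magnitude set-point of node k, and ths k is its angle
   set-point relative to the first node. *)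
Variables (vs ths : 'I_N -> R).

Definition angle_sp (j k : 'I_N) : R := ths j - ths k.

Definition gainK (k : 'I_N) : 'M[R]_2 :=
  \sum_(j | adj j k)
     weight j k *: (1%:M - (vs j / vs k) *: Rot (angle_sp j k)).

Definition Phi (k : 'I_N) (x : 'cV[R]_2) : R := (vs k - enorm x) / vs k.

Definition p_sp (k : 'I_N) : R :=
  \sum_(j | adj j k)
    (vs k ^+ 2 * r [set j; k]
     - vs k * vs j * (r [set j; k] * cos (angle_sp j k)
                      + omega0 * l [set j; k] * sin (angle_sp j k)))
    / (r [set j; k] ^+ 2 + omega0 ^+ 2 * l [set j; k] ^+ 2).

Definition q_sp (k : 'I_N) : R :=
  \sum_(j | adj j k)
    (vs k ^+ 2 * (omega0 * l [set j; k])
     - vs k * vs j * (omega0 * l [set j; k] * cos (angle_sp j k)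
                      - r [set j; k] * sin (angle_sp j k)))
    / (r [set j; k] ^+ 2 + omega0 ^+ 2 * l [set j; k] ^+ 2).

Variables (kappa eta alpha : R).

Definition closed_loop_rhs (u : 'I_N -> 'cV[R]_2) (k : 'I_N) : 'cV[R]_2 :=
  omega0 *: (J *m u k)
  + eta *: (gainK k *m u k - Rot kappa *m output_current u k)
  + (alpha * Phi k (u k)) *: u k.

End Network.

(* Main.v *)
(* For lossless lines K_k is a combination of I and J with coefficients
   q*_k / v*_k^2 and p*_k / v*_k^2.  Since kappa = pi/2, the current term is
   J i_{o,k}, whose coordinates in the orthogonal frame (v_k, J v_k) are
   q_k / nu_k^2 and p_k / nu_k^2.  So the right-hand side is a v_k + c J v_k with
   real a, c, and for v = nu (cos theta, sin theta) the equation
   v' = a v + c J v means nu' = a nu and theta' = c. *)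
Require Import Defs.
From HB Require Import structures.
From mathcomp Require Import all_boot all_order all_algebra.
From mathcomp Require Import all_classical all_reals all_analysis.
From mathcomp Require Import ring.
Import Order.TTheory GRing.Theory Num.Theory.
Import numFieldNormedType.Exports.
Local Open Scope classical_set_scope.
Local Open Scope ring_scope.

(** * Rotations and the frame [u], [J *m u] in the plane *)

Section Plane.
Context {R : realType}.
Implicit Types (u z : 'cV[R]_2) (a c x y : R).

Lemma col2P u z : u 0 0 = z 0 0 -> u 1 0 = z 1 0 -> u = z.
Proof.
move=> u0 u1; apply/matrixP => i j; rewrite (ord1 j).
case: i => [[|[|//]] ?]; first by rewrite (_ : Ordinal _ = 0) //; apply: val_inj.
by rewrite (_ : Ordinal _ = 1) //; apply: val_inj.
Qed.

Lemma big_ord2 (F : 'I_2 -> R) : \sum_(i < 2) F i = F 0 + F 1.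
Proof.
by rewrite !big_ord_recl big_ord0 addr0; congr (_ + F _); apply: val_inj.
Qed.

Lemma col2_0 x y : col2 x y 0 0 = x.
Proof. by rewrite mxE. Qed.

Lemma col2_1 x y : col2 x y 1 0 = y.
Proof. by rewrite mxE. Qed.

Lemma Rot_mul a u :
  Rot a *m u = col2 (cos a * u 0 0 - sin a * u 1 0)
                    (sin a * u 0 0 + cos a * u 1 0).
Proof.
by apply: col2P; rewrite !mxE big_ord2 !mxE /= ?mulNr.
Qed.

Lemma J_mul u : J *m u = col2 (- u 1 0) (u 0 0).
Proof. by rewrite Rot_mul cos_pihalf sin_pihalf !mul0r !mul1r sub0r addr0. Qed.

Lemma addZJ_0 a c u : (a *: u + c *: (J *m u)) 0 0 = a * u 0 0 - c * u 1 0.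
Proof. by rewrite J_mul mxE [X in X + _]mxE [X in _ + X]mxE col2_0 mulrN. Qed.

Lemma addZJ_1 a c u : (a *: u + c *: (J *m u)) 1 0 = a * u 1 0 + c * u 0 0.
Proof. by rewrite J_mul mxE [X in X + _]mxE [X in _ + X]mxE col2_1. Qed.

Lemma Rot_polar a x : Rot a *m col2 x 0 = col2 (x * cos a) (x * sin a).
Proof. by rewrite Rot_mul col2_0 col2_1 !mulr0 subr0 addr0 ![_ * x]mulrC. Qed.

Lemma RotE a : Rot a = cos a *: 1%:M + sin a *: (J : 'M[R]_2).
Proof.
apply/matrixP => i j; rewrite !mxE cos_pihalf sin_pihalf.
by case: i => [[|[|//]] ?]; case: j => [[|[|//]] ?]; rewrite /=; ring.
Qed.

Lemma dotmulE u z : dotmul u z = u 0 0 * z 0 0 + u 1 0 * z 1 0.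
Proof. by rewrite /dotmul !mxE big_ord2 !mxE. Qed.

Lemma enorm_sqr u : enorm u ^+ 2 = u 0 0 ^+ 2 + u 1 0 ^+ 2.
Proof.
rewrite /enorm sqr_sqrtr; last by rewrite sumr_ge0 // => i _; apply: sqr_ge0.
exact: big_ord2.
Qed.

(** [u] and [J *m u] are orthogonal and both have norm [enorm u]. Since [J] is an isometry, the
    component of [J *m z] along [J *m u] is governed by [dotmul u z]; with [z] the output current
    the two coefficients are the reactive and the active power over the squared norm. *)
Lemma decompose_J u z : 0 < enorm u ->
  J *m z = (dotmul u (J *m z) / enorm u ^+ 2) *: u
           + (dotmul u z / enorm u ^+ 2) *: (J *m u).
Proof.
move=> u_gt0; have : enorm u ^+ 2 != 0 by rewrite gt_eqF ?exprn_gt0.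
rewrite !dotmulE enorm_sqr => u_neq0.
by apply: col2P; rewrite ?addZJ_0 ?addZJ_1 !J_mul !(col2_0, col2_1); field.
Qed.

End Plane.

(** * Passing between derivatives of a planar curve and of its polar coordinates *)

Section Polar.
Context {R : realType}.

Lemma is_derive_col2P (v : R -> 'cV[R]_2) (t : R) (z : 'cV[R]_2) :
  is_derive t 1 v z <->
  is_derive t 1 (fun s => v s 0 0) (z 0 0) /\
  is_derive t 1 (fun s => v s 1 0) (z 1 0).
Proof.
split=> [[dv <-]|[dx dy]].
  rewrite derive_mx // !mxE.
  by split; apply: derivableP; move/derivable_mxP: dv; apply.
have dv : derivable v t 1.
  apply/derivable_mxP => i j; rewrite (ord1 j).
  case: i => [[|[|//]] ?].
    by rewrite (_ : Ordinal _ = 0); [case: dx | apply: val_inj].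
  by rewrite (_ : Ordinal _ = 1); [case: dy | apply: val_inj].
apply: DeriveDef => //; rewrite derive_mx //.
by apply: col2P; rewrite mxE; [case: dx | case: dy].
Qed.

Variables (nu theta : R -> R) (v : R -> 'cV[R]_2) (t a c : R).
Hypothesis nu_gt0 : \forall s \near t, 0 < nu s.
Hypothesis polar : \forall s \near t, v s = Rot (theta s) *m col2 (nu s) 0.

Lemma is_derive_of_polar :
  is_derive t 1 nu (a * nu t) -> is_derive t 1 theta c ->
  is_derive t 1 v (a *: v t + c *: (J *m v t)).
Proof.
move=> dnu dth.
have vt := nbhs_singleton polar.
have dc : is_derive t 1 (cos \o theta) (- sin (theta t) * c).
  exact: is_derive1_comp.
have ds : is_derive t 1 (sin \o theta) (cos (theta t) * c).
  exact: is_derive1_comp.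
apply/is_derive_col2P; rewrite addZJ_0 addZJ_1 vt Rot_polar.
rewrite !(col2_0, col2_1); split.
  apply: (@near_eq_is_derive _ _ _ (nu * (cos \o theta))).
    by near=> s; rewrite (near polar s) // Rot_polar col2_0.
  by apply: is_derive_eq; rewrite /GRing.scale /=; ring.
apply: (@near_eq_is_derive _ _ _ (nu * (sin \o theta))).
  by near=> s; rewrite (near polar s) // Rot_polar col2_1.
by apply: is_derive_eq; rewrite /GRing.scale /=; ring.
Unshelve. all: by end_near. Qed.

(** Near [t] the radius is the square root of [x ^+ 2 + y ^+ 2], hence differentiable. The [c] part
    of the velocity is orthogonal to [v t], so only [a] contributes. *)
Lemma is_derive_radius :
  is_derive t 1 v (a *: v t + c *: (J *m v t)) ->
  is_derive t 1 nu (a * nu t).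
Proof.
move=> /is_derive_col2P [dx dy].
have nut := nbhs_singleton nu_gt0.
have vt := nbhs_singleton polar.
set x := fun s => v s 0 0 in dx; set y := fun s => v s 1 0 in dy.
have nu2 s : v s = Rot (theta s) *m col2 (nu s) 0 ->
    x s ^+ 2 + y s ^+ 2 = nu s ^+ 2.
  rewrite /x /y => ->; rewrite Rot_polar col2_0 col2_1 !exprMn -mulrDr.
  by rewrite cos2Dsin2 mulr1.
have ds : is_derive (x t ^+ 2 + y t ^+ 2) 1 Num.sqrt (2 * nu t)^-1.
  rewrite nu2 // -[X in _ * X](gtr0_norm nut) -sqrtr_sqr.
  by apply: is_derive1_sqrt; rewrite exprn_gt0.
apply: (@near_eq_is_derive _ _ _ (Num.sqrt \o (x ^+ 2 + y ^+ 2))).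
  near=> s; rewrite /= [LHS](_ : _ = Num.sqrt (x s ^+ 2 + y s ^+ 2)) //.
  rewrite nu2; last by near: s.
  by rewrite sqrtr_sqr gtr0_norm //; near: s.
apply: is_derive_eq.
rewrite addZJ_0 addZJ_1 -/(x t) -/(y t) /GRing.scale /=.
(* Multiplying and dividing by [2 * nu t] makes [nu t ^+ 2] appear, which [nu2] turns back into
   [x t ^+ 2 + y t ^+ 2]. *)
rewrite -[RHS](mulrK (x := 2 * nu t)) ?unitfE ?mulf_neq0 ?gt_eqF //.
rewrite [RHS](_ : _ = 2 * a * nu t ^+ 2 / (2 * nu t)); last by ring.
by rewrite -nu2 //; ring.
Unshelve. all: by end_near. Qed.

(* Near t the continuous angle is theta t + asin of the normalised cross product
   of v t and v s, which is differentiable in s. *)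
Lemma is_derive_angle : {for t, continuous theta} ->
  is_derive t 1 v (a *: v t + c *: (J *m v t)) -> is_derive t 1 theta c.
Proof.
move=> cth dv; have dnu := is_derive_radius dv.
move/is_derive_col2P: dv => [dx dy].
have nut := nbhs_singleton nu_gt0.
have nut0 : nu t != 0 by rewrite gt_eqF.
have vt := nbhs_singleton polar.
set x := fun s => v s 0 0 in dx; set y := fun s => v s 1 0 in dy.
pose sn := (cos (theta t) *: y - sin (theta t) *: x) * (fun s => (nu s)^-1).
have snt : sn t = 0.
  rewrite [LHS](_ : _ =
    (cos (theta t) * v t 1 0 - sin (theta t) * v t 0 0) / nu t) //.
  by rewrite vt Rot_polar col2_0 col2_1; ring.
(* The numerator of [sn] vanishes at [t], so the derivative of [1 / nu] drops out; the derivative of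
   the numerator is [c * nu t]. *)
have dsn : is_derive t 1 sn c.
  rewrite /sn; have dV := is_deriveV nut0 dnu.
  apply: is_derive_eq; rewrite addZJ_0 addZJ_1 /GRing.scale /=.
  rewrite [X in X * _](_ : _ =
    cos (theta t) * v t 1 0 - sin (theta t) * v t 0 0) //.
  rewrite vt Rot_polar col2_0 col2_1 -[RHS]mulr1 -(cos2Dsin2 (theta t)).
  by field.
have da : is_derive t 1 (asin \o sn) c.
  have d0 : is_derive (sn t) 1 (@asin R) 1.
    rewrite snt; have := @is_derive1_asin R 0.
    by rewrite expr0n subr0 sqrtr1 invr1; apply; rewrite ltrN10 ltr01.
  by apply: is_derive_eq; rewrite mul1r.
apply: (@near_eq_is_derive _ _ _ (cst (theta t) + (asin \o sn))).
  near=> s.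
  have -> : (cst (theta t) + (asin \o sn)) s = theta t + asin (sn s) by [].
  have -> : sn s = sin (theta s - theta t).
    rewrite [LHS](_ : _ =
      (cos (theta t) * v s 1 0 - sin (theta t) * v s 0 0) / nu s) //.
    have -> : v s = Rot (theta s) *m col2 (nu s) 0 by near: s.
    have : nu s != 0 by rewrite gt_eqF //; near: s.
    by move=> ?; rewrite Rot_polar col2_0 col2_1 sinB; field.
  (* [asin] inverts [sin] only on angles of size at most [pi / 2]; continuity of [theta] keeps
     [theta s - theta t] in that range and so excludes jumps by multiples of [2 * pi]. *)
  rewrite sinK ?subrKC // in_itv /= -ler_norml ltW // distrC.
  by near: s; move/cvgrPdist_lt: cth; apply; rewrite divr_gt0 ?pi_gt0.
by apply: is_derive_eq; rewrite add0r.
Unshelve. all: by end_near. Qed.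

End Polar.

(** * The lossless closed loop in the frame of each voltage *)

Section ClosedLoop.
Context {R : realType} {N : nat}.
Variables (adj : rel 'I_N) (src snk : 'I_#|lines adj| -> 'I_N).
Variables (r l : {set 'I_N} -> R) (omega0 eta alpha : R) (vs ths : 'I_N -> R).
Hypothesis l_gt0 : forall j k, adj j k -> 0 < l [set j; k]%SET.
Hypothesis omega0_gt0 : 0 < omega0.
Hypothesis vs_gt0 : forall k, 0 < vs k.
Hypothesis r_eq0 : forall j k, adj j k -> r [set j; k]%SET = 0.

(** With zero resistance the weight is [1 / (omega0 * l)], and each summand of the power-flow
    equations keeps one trigonometric term: the cosine in [q_sp], the sine in [p_sp]. These are the
    [1%:M] and [J] parts of the rotation in [gainK]. *)
Lemma gainK_lossless k :
  gainK adj r l omega0 vs ths k =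
  (q_sp adj r l omega0 vs ths k / vs k ^+ 2) *: 1%:M
  + (p_sp adj r l omega0 vs ths k / vs k ^+ 2) *: J.
Proof.
rewrite /gainK /q_sp /p_sp !mulr_suml !scaler_suml -big_split /=.
apply: eq_bigr => j jk; rewrite /weight r_eq0 //.
have lj := l_gt0 j k jk; have vk := vs_gt0 k.
rewrite expr0n add0r -exprMn sqrtr_sqr gtr0_norm ?mulr_gt0 // RotE.
apply/matrixP => i i'; rewrite !mxE /=.
by field; rewrite ?gt_eqF.
Qed.

Lemma closed_loop_rhs_lossless (u : 'I_N -> 'cV[R]_2) k : 0 < enorm (u k) ->
  let n := enorm (u k) in
  let p := active_power src snk r l omega0 u k in
  let q := reactive_power src snk r l omega0 u k in
  let p_star := p_sp adj r l omega0 vs ths k in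
  let q_star := q_sp adj r l omega0 vs ths k in
  closed_loop_rhs src snk r l omega0 vs ths (pi / 2) eta alpha u k =
  (eta * (q_star / vs k ^+ 2 - q / n ^+ 2) + alpha / vs k * (vs k - n)) *: u k
  + (omega0 + eta * (p_star / vs k ^+ 2 - p / n ^+ 2)) *: (J *m u k).
Proof.
move=> n_gt0 n p q p_star q_star.
rewrite /closed_loop_rhs gainK_lossless -/J mulmxDl -!scalemxAl mul1mx.
rewrite (decompose_J _ (output_current _ _ _ _ _ _ _) n_gt0).
rewrite -/(active_power _ _ _ _ _ _ _) -/(reactive_power _ _ _ _ _ _ _) /Phi.
(* With [J *m u k] made opaque, both sides are combinations of two vectors and agree coefficient by
   coefficient. *)
rewrite -/p -/q -/p_star -/q_star -/n; move: (J *m u k) => Ju.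
by apply: col2P; rewrite !mxE; ring.
Qed.

End ClosedLoop.

Theorem proposition4 (R : realType) (N : nat) (adj : rel 'I_N)
    (src snk : 'I_#|lines adj| -> 'I_N) (r l : {set 'I_N} -> R)
    (omega0 eta alpha : R) (vs ths : 'I_N -> R)
    (simple_adj : simple_graph adj)
    (connected_adj : connected_graph adj)
    (oriented : orientation src snk)
    (l_gt0 : forall j k, adj j k -> 0 < l [set j; k]%SET)
    (omega0_gt0 : 0 < omega0) (eta_gt0 : 0 < eta) (alpha_gt0 : 0 < alpha)
    (vs_gt0 : forall k, 0 < vs k)
    (r_eq0 : forall j k, adj j k -> r [set j; k]%SET = 0)
    (D : set R) (openD : open D)
    (v : 'I_N -> R -> 'cV[R]_2) (nu theta : 'I_N -> R -> R)
    (nuE : forall k t, D t -> nu k t = enorm (v k t))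
    (nu_gt0 : forall k t, D t -> 0 < nu k t)
    (polar : forall k t, D t -> v k t = Rot (theta k t) *m col2 (nu k t) 0)
    (theta_continuous : forall k t, D t -> {for t, continuous (theta k)}) :
  (forall k t, D t ->
     is_derive t 1 (v k)
       (closed_loop_rhs src snk r l omega0 vs ths (pi / 2) eta alpha
          (fun j => v j t) k))
  <->
  (forall k t, D t ->
     let p := active_power src snk r l omega0 (fun j => v j t) k in
     let q := reactive_power src snk r l omega0 (fun j => v j t) k in
     let p_star := p_sp adj r l omega0 vs ths k in
     let q_star := q_sp adj r l omega0 vs ths k in
     is_derive t 1 (nu k)
       (eta * (q_star / vs k ^+ 2 - q / nu k t ^+ 2) * nu k t
        + alpha / vs k * (vs k - nu k t) * nu k t) /\
     is_derive t 1 (theta k)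
       (omega0 + eta * (p_star / vs k ^+ 2 - p / nu k t ^+ 2))).
Proof.
(* Openness of [D] turns the hypotheses on [D] into the neighbourhood conditions of the polar
   lemmas. *)
have near_D t : D t -> \forall s \near t, D s by move=> Dt; apply: open_nbhs_nbhs.
have near_gt0 k t : D t -> \forall s \near t, 0 < nu k s.
  by move=> /near_D; apply: filterS => s /nu_gt0.
have near_polar k t : D t ->
    \forall s \near t, v k s = Rot (theta k s) *m col2 (nu k s) 0.
  by move=> /near_D; apply: filterS => s /polar.
(* The nodes are coupled only through the powers at the instant [t], which are constants there; each
   node can thus be treated separately. *)
have rhsE k t (Dt : D t) := closed_loop_rhs_lossless adj src snk r l omega0 eta
  alpha vs ths l_gt0 omega0_gt0 vs_gt0 r_eq0 (fun j => v j t) k.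
split=> [dv k t Dt | dpolar k t Dt].
  have := dv k t Dt; rewrite rhsE -?nuE ?nu_gt0 // => dvk.
  have gt0 := near_gt0 k t Dt; have pol := near_polar k t Dt.
  split; last exact: is_derive_angle gt0 pol (theta_continuous k t Dt) dvk.
  rewrite -mulrDl; exact: is_derive_radius gt0 pol dvk.
have [dnu dth] := dpolar k t Dt; rewrite rhsE -?nuE ?nu_gt0 //.
apply: is_derive_of_polar (near_polar k t Dt) _ dth.
by rewrite mulrDl.
Qed.
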